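(* Let $\hat{\mathbf q}=\tilde{\mathbf q}_{\mathrm{st}}+\tilde{\mathbf q}_{\mathcal I}\epsilon\in\hat{\mathbb Q}^{n\times1}$ be a dual quaternion vector, and let $\hat{\mathbb Q}_2^{n\times 1}$ be the set of dual quaternion vectors with unit $2$-norm. (i) If $\tilde{\mathbf q}_{\mathrm{st}}\neq \mathbf 0$, then the normalization $$\hat{\mathbf u}=\frac{\hat{\mathbf q}}{\|\hat{\mathbf q}\|_2}=\tilde{\mathbf u}_{\mathrm{st}}+\tilde{\mathbf u}_{\mathcal I}\epsilon,\quad \tilde{\mathbf u}_{\mathrm{st}}=\frac{\tilde{\mathbf q}_{\mathrm{st}}}{\|\tilde{\mathbf q}_{\mathrm{st}}\|_2},\quad \tilde{\mathbf u}_{\mathcal I}=\frac{\tilde{\mathbf q}_{\mathcal I}}{\|\tilde{\mathbf q}_{\mathrm{st}}\|_2}-\frac{\tilde{\mathbf q}_{\mathrm{st}}}{\|\tilde{\mathbf q}_{\mathrm{st}}\|_2}\,sc\!\left(\frac{\tilde{\mathbf q}_{\mathrm{st}}^*}{\|\tilde{\mathbf q}_{\mathrm{st}}\|_2}\frac{\tilde{\mathbf q}_{\mathcal I}}{\|\tilde{\mathbf q}_{\mathrm{st}}\|_2}\right)$$ is a dual quaternion vector with unit norm and is a projection of $\hat{\mathbf q}$ onto $\hat{\mathbb Q}_2^{n\times1}$, i.e. $$\hat{\mathbf u}\in\mathop{\arg\min}_{\hat{\mathbf v}\in\hat{\mathbb Q}_2^{n\times1}}\ \|\hat{\mathbf v}-\hat{\mathbf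 q}\|_2^2 .$$ (ii) If $\tilde{\mathbf q}_{\mathrm{st}}=\mathbf 0$ and $\tilde{\mathbf q}_{\mathcal I}\ne\mathbf 0$, then the projection of $\hat{\mathbf q}$ onto $\hat{\mathbb Q}_2^{n\times1}$ (a minimizer of $\|\hat{\mathbf v}-\hat{\mathbf q}\|_2^2$ over $\hat{\mathbf v}\in\hat{\mathbb Q}_2^{n\times1}$) is $\hat{\mathbf u}=\tilde{\mathbf u}_{\mathrm{st}}+\tilde{\mathbf u}_{\mathcal I}\epsilon$, where $\tilde{\mathbf u}_{\mathrm{st}}=\frac{\tilde{\mathbf q}_{\mathcal I}}{\|\tilde{\mathbf q}_{\mathcal I}\|_2}$ and $\tilde{\mathbf u}_{\mathcal I}\in\mathbb Q^{n\times1}$ is any quaternion vector satisfying $sc(\tilde{\mathbf q}_{\mathcal I}^*\tilde{\mathbf u}_{\mathcal I})=0$.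
   Context: Dual numbers: $a=a_{\mathrm{st}}+a_{\mathcal I}\epsilon$ with $a_{\mathrm{st}},a_{\mathcal I}\in\mathbb R$, $\epsilon\ne0$, $\epsilon^2=0$; totally ordered by: $a>b$ iff $a_{\mathrm{st}}>b_{\mathrm{st}}$, or $a_{\mathrm{st}}=b_{\mathrm{st}}$ and $a_{\mathcal I}>b_{\mathcal I}$. Minimization of dual-number-valued functions is with respect to this order. If $a_{\mathrm{st}}>0$, $\sqrt a=\sqrt{a_{\mathrm{st}}}+\frac{a_{\mathcal I}}{2\sqrt{a_{\mathrm{st}}}}\epsilon$. $\mathbb Q$ is the set of real (Hamilton) quaternions, with conjugate $\tilde q^*$, magnitude $|\tilde q|$, scalar part $sc(\tilde q)=\frac12(\tilde q+\tilde q^* )$ (a real number). A dual quaternion is $\hat q=\tilde q_{\mathrm{st}}+\tilde q_{\mathcal I}\epsilon$, with $\tilde q_{\mathrm{st}},\tilde q_{\mathcal I}\in\mathbb Q$ and $\epsilon$ commuting with quaternions; its set is $\hat{\mathbb Q}$. Its magnitude is the dual number $|\hat q|=|\tilde q_{\mathrm{st}}|+\frac{sc(\tilde q_{\mathrm{st}}^*\tilde q_{\mathcal I})}{|\tilde q_{\mathrm{st}}|}\epsilon$ if $\tilde q_{\mathrm{st}}\ne\tilde 0$, and $|\tilde q_{\mathcal I}|\epsilon$ otherwise. A dual quaternion vector is $\hat{\mathbf x}=(\hat x_i)=\tilde{\mathbf x}_{\mathrm{st}}+\tilde{\mathbf x}_{\mathcal I}\epsilon\in\hat{\mathbb Q}^{n\times1}$;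 $\hat{\mathbf x}^*$ is its conjugate transpose. Its $2$-norm is the dual number $\|\hat{\mathbf x}\|_2=\sqrt{\sum_{i}|\hat x_i|^2}$ if $\tilde{\mathbf x}_{\mathrm{st}}\neq\mathbf 0$, and $\|\hat{\mathbf x}\|_2=\sqrt{\sum_i|\tilde x_{i,\mathcal I}|^2}\,\epsilon$ if $\tilde{\mathbf x}_{\mathrm{st}}=\mathbf 0$. For a quaternion vector, $\|\tilde{\mathbf x}\|_2=\sqrt{\sum_i|\tilde x_i|^2}$. $\hat{\mathbb Q}_2^{n\times1}=\{\hat{\mathbf v}\in\hat{\mathbb Q}^{n\times1}:\|\hat{\mathbf v}\|_2=1\}$. For a dual number $a$ with $a_{\mathrm{st}}\ne0$, division is (entrywise) $\frac{\hat q}{a}=\frac{\tilde q_{\mathrm{st}}}{a_{\mathrm{st}}}+\left(\frac{\tilde q_{\mathcal I}}{a_{\mathrm{st}}}-\frac{\tilde q_{\mathrm{st}}}{a_{\mathrm{st}}}\frac{a_{\mathcal I}}{a_{\mathrm{st}}}\right)\epsilon$. *)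

(* Defs.v *)
From HB Require Import structures.
From mathcomp Require Import all_boot all_order all_algebra.
From mathcomp Require Import ring.
From mathcomp Require Import classical_sets.

Set Implicit Arguments.
Unset Strict Implicit.
Unset Printing Implicit Defensive.

Import Order.TTheory GRing.Theory Num.Theory.
Local Open Scope ring_scope.

(* Quat a b c d stands for a + b i + c j + d k. *)
Record quat (R : Type) := Quat { q0 : R; q1 : R; q2 : R; q3 : R }.

Section QuatEncoding.
Variable R : Type.
Definition tuple_of_quat (p : quat R) := (q0 p, q1 p, q2 p, q3 p).
Definition quat_of_tuple (t : R * R * R * R) :=
  let: (a, b, c, d) := t in Quat a b c d.
Lemma tuple_of_quatK : cancel tuple_of_quat quat_of_tuple.
Proof. by case. Qed.
End QuatEncoding.

HB.instance Definition _ (R : eqType) :=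
  Equality.copy (quat R) (can_type (@tuple_of_quatK R)).
HB.instance Definition _ (R : choiceType) :=
  Choice.copy (quat R) (can_type (@tuple_of_quatK R)).

Section QuatAlgebra.
Variable R : comNzRingType.
Implicit Types p q : quat R.

Definition addq p q :=
  Quat (q0 p + q0 q) (q1 p + q1 q) (q2 p + q2 q) (q3 p + q3 q).
Definition oppq p := Quat (- q0 p) (- q1 p) (- q2 p) (- q3 p).
Definition zeroq : quat R := Quat 0 0 0 0.
Definition oneq : quat R := Quat 1 0 0 0.

(* Hamilton product: i^2 = j^2 = k^2 = ijk = -1. *)
Definition mulq p q :=
  Quat (q0 p * q0 q - q1 p * q1 q - q2 p * q2 q - q3 p * q3 q)
       (q0 p * q1 q + q1 p * q0 q + q2 p * q3 q - q3 p * q2 q)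
       (q0 p * q2 q - q1 p * q3 q + q2 p * q0 q + q3 p * q1 q)
       (q0 p * q3 q + q1 p * q2 q - q2 p * q1 q + q3 p * q0 q).
Definition scaleq (r : R) p := Quat (r * q0 p) (r * q1 p) (r * q2 p) (r * q3 p).

Lemma addqA : associative addq.
Proof. by move=> p q r; rewrite /addq /= !addrA. Qed.
Lemma addqC : commutative addq.
Proof. by move=> p q; congr Quat; rewrite addrC. Qed.
Lemma add0q : left_id zeroq addq.
Proof. by case=> *; rewrite /addq /= !add0r. Qed.
Lemma addNq : left_inverse zeroq oppq addq.
Proof. by move=> p; rewrite /addq /= !addNr. Qed.
HB.instance Definition _ := GRing.isZmodule.Build (quat R) addqA addqC add0q addNq.

Lemma mulqA : associative mulq.
Proof. by move=> p q r; congr Quat => /=; ring. Qed.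
Lemma mul1q : left_id oneq mulq.
Proof. by case=> *; congr Quat => /=; ring. Qed.
Lemma mulq1 : right_id oneq mulq.
Proof. by case=> *; congr Quat => /=; ring. Qed.
Lemma mulqDl : left_distributive mulq +%R.
Proof. by move=> p q r; congr Quat => /=; ring. Qed.
Lemma mulqDr : right_distributive mulq +%R.
Proof. by move=> p q r; congr Quat => /=; ring. Qed.
Lemma oneq_neq0 : oneq != 0.
Proof. by apply/eqP => -[/eqP]; rewrite oner_eq0. Qed.
HB.instance Definition _ :=
  GRing.Zmodule_isNzRing.Build (quat R) mulqA mul1q mulq1 mulqDl mulqDr oneq_neq0.

Lemma scaleqA a b p : scaleq a (scaleq b p) = scaleq (a * b) p.
Proof. by congr Quat => /=; rewrite mulrA. Qed.
Lemma scale1q : left_id 1 scaleq.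
Proof. by case=> *; congr Quat; rewrite /= mul1r. Qed.
Lemma scaleqDr : right_distributive scaleq +%R.
Proof. by move=> r p q; congr Quat; rewrite /= mulrDr. Qed.
Lemma scaleqDl p : {morph scaleq^~ p : a b / a + b}.
Proof. by move=> a b; congr Quat; rewrite /= mulrDl. Qed.
HB.instance Definition _ :=
  GRing.Zmodule_isLmodule.Build R (quat R) scaleqA scale1q scaleqDr scaleqDl.

Definition conjq p := Quat (q0 p) (- q1 p) (- q2 p) (- q3 p).

End QuatAlgebra.

(* Dual a b stands for a + b epsilon, with standard part a and
   infinitesimal part b; dual R are the dual numbers and dual (quat R) the
   dual quaternions. *)
Record dual (A : Type) := Dual { stpart : A; infpart : A }.

Section DualEncoding.
Variable A : Type.
Definition pair_of_dual (x : dual A) := (stpart x, infpart x).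
Definition dual_of_pair (t : A * A) := Dual t.1 t.2.
Lemma pair_of_dualK : cancel pair_of_dual dual_of_pair.
Proof. by case. Qed.
End DualEncoding.

HB.instance Definition _ (A : eqType) :=
  Equality.copy (dual A) (can_type (@pair_of_dualK A)).
HB.instance Definition _ (A : choiceType) :=
  Choice.copy (dual A) (can_type (@pair_of_dualK A)).

Section DualZmodule.
Variable A : zmodType.
Implicit Types x y : dual A.

Definition addd x y := Dual (stpart x + stpart y) (infpart x + infpart y).
Definition oppd x := Dual (- stpart x) (- infpart x).
Definition zerod : dual A := Dual 0 0.

Lemma adddA : associative addd.
Proof. by move=> x y z; rewrite /addd /= !addrA. Qed.
Lemma adddC : commutative addd.
Proof. by move=> x y; congr Dual; rewrite addrC. Qed.
Lemma add0d : left_id zerod addd.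
Proof. by case=> *; rewrite /addd /= !add0r. Qed.
Lemma addNd : left_inverse zerod oppd addd.
Proof. by move=> x; rewrite /addd /= !addNr. Qed.
HB.instance Definition _ := GRing.isZmodule.Build (dual A) adddA adddC add0d addNd.

End DualZmodule.

Section DualRing.
Variable A : nzRingType.
Implicit Types x y : dual A.

Definition oned : dual A := Dual 1 0.
(* epsilon is central and epsilon^2 = 0 *)
Definition muld x y :=
  Dual (stpart x * stpart y) (stpart x * infpart y + infpart x * stpart y).

Lemma muldA : associative muld.
Proof.
by move=> x y z; congr Dual => /=; rewrite ?mulrDr ?mulrDl !mulrA ?addrA.
Qed.
Lemma mul1d : left_id oned muld.
Proof. by case=> *; rewrite /muld /= !mul1r mul0r addr0. Qed.
Lemma muld1 : right_id oned muld.
Proof. by case=> *; rewrite /muld /= !mulr1 mulr0 add0r. Qed.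
Lemma muldDl : left_distributive muld +%R.
Proof. by move=> x y z; congr Dual => /=; rewrite !mulrDl // addrACA. Qed.
Lemma muldDr : right_distributive muld +%R.
Proof. by move=> x y z; congr Dual => /=; rewrite !mulrDr // addrACA. Qed.
Lemma oned_neq0 : oned != 0.
Proof. by apply/eqP => -[/eqP]; rewrite oner_eq0. Qed.
HB.instance Definition _ :=
  GRing.Zmodule_isNzRing.Build (dual A) muldA mul1d muld1 muldDl muldDr oned_neq0.

End DualRing.

Section DualOrder.
Variable R : realDomainType.
Implicit Types a b : dual R.

Definition ltd a b :=
  (stpart a < stpart b) || (stpart a == stpart b) && (infpart a < infpart b).
Definition led a b := (a == b) || ltd a b.

Lemma ltd_irr : irreflexive ltd.
Proof. by move=> a; rewrite /ltd !ltxx andbF. Qed.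
Lemma ltd_trans : transitive ltd.
Proof.
move=> b a c; rewrite /ltd.
move=> /orP[ab|/andP[/eqP-> ab]] /orP[bc|/andP[/eqP bc bc']].
- by rewrite (lt_trans ab bc).
- by rewrite -bc ab.
- by rewrite bc.
- by rewrite bc eqxx (lt_trans ab bc') orbT.
Qed.
Lemma ltd_total a b : a != b -> ltd a b || ltd b a.
Proof.
case: a b => [a a'] [b b'] ab; rewrite /ltd /=.
case: (ltgtP a b) => //= eab; case: (ltgtP a' b') => //= eab'.
by rewrite eab eab' eqxx in ab.
Qed.
HB.instance Definition _ := Order.LtOrder.Build ring_display (dual R)
  (fun _ _ => erefl (led _ _)) (fun _ _ => erefl) (fun _ _ => erefl)
  ltd_irr ltd_trans ltd_total.

End DualOrder.

Section DualQuaternionVectors.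
Variable R : rcfType.

(* Meaningful only for stpart a > 0. *)
Definition sqrtd (a : dual R) : dual R :=
  Dual (Num.sqrt (stpart a)) (infpart a / (2 * Num.sqrt (stpart a))).

(* The quaternion (q + q^* ) / 2 is real (lemma sc_real) and is read as an
   element of R through its real coordinate. *)
Definition sc (q : quat R) : R := q0 (2^-1 *: (q + conjq q)).

Lemma sc_real (q : quat R) : 2^-1 *: (q + conjq q) = sc q *: (1 : quat R).
Proof. by rewrite /sc; congr Quat; rewrite /= ?mulr1 // mulr0 subrr mulr0. Qed.

Definition normq (q : quat R) : R :=
  Num.sqrt (q0 q ^+ 2 + q1 q ^+ 2 + q2 q ^+ 2 + q3 q ^+ 2).

Definition normdq (q : dual (quat R)) : dual R :=
  if stpart q != 0 then
    Dual (normq (stpart q))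
         (sc (conjq (stpart q) * infpart q) / normq (stpart q))
  else Dual 0 (normq (infpart q)).

(* Quotient by a dual number, meaningful only for stpart a != 0. *)
Definition divdq (q : dual (quat R)) (a : dual R) : dual (quat R) :=
  Dual ((stpart a)^-1 *: stpart q)
       ((stpart a)^-1 *: infpart q
        - (infpart a / stpart a) *: ((stpart a)^-1 *: stpart q)).

Definition conjtr m n (A : 'M[quat R]_(m, n)) : 'M[quat R]_(n, m) :=
  (map_mx (@conjq R) A)^T.

(* The library's *: on matrices over quat R takes quaternion scalars; this is
   entrywise multiplication by a real number. *)
Definition scalemq m n (r : R) (A : 'M[quat R]_(m, n)) : 'M[quat R]_(m, n) :=
  map_mx ( *:%R r) A.

Variable n : nat.

Definition normqv (x : 'cV[quat R]_n) : R :=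
  Num.sqrt (\sum_(i < n) normq (x i 0) ^+ 2).

Definition stv (x : 'cV[dual (quat R)]_n) : 'cV[quat R]_n := map_mx (@stpart _) x.
Definition infv (x : 'cV[dual (quat R)]_n) : 'cV[quat R]_n := map_mx (@infpart _) x.
Definition dualv (x y : 'cV[quat R]_n) : 'cV[dual (quat R)]_n :=
  map2_mx (@Dual _) x y.

Definition normdqv (x : 'cV[dual (quat R)]_n) : dual R :=
  if stv x != 0 then sqrtd (\sum_(i < n) normdq (x i 0) ^+ 2)
  else Dual 0 (Num.sqrt (\sum_(i < n) normq (infpart (x i 0)) ^+ 2)).

Definition divdqv (x : 'cV[dual (quat R)]_n) (a : dual R) :
    'cV[dual (quat R)]_n :=
  map_mx (divdq^~ a) x.

Definition unit_dqv : set 'cV[dual (quat R)]_n := [set v | normdqv v = 1]%classic.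

End DualQuaternionVectors.

Arguments unit_dqv : clear implicits.

Definition argmin d (V : porderType d) (T : Type) (S : set T) (f : T -> V) : set T :=
  [set u | S u /\ forall v, S v -> (f u <= f v)%O]%classic.

(* Main.v *)
Require Import Defs.
From mathcomp Require Import all_boot all_order all_algebra.
From mathcomp Require Import classical_sets reals.
From mathcomp Require Import ring lra.
Import Order.TTheory GRing.Theory Num.Theory.
Local Open Scope ring_scope.

(** The real inner product <x, y> = sc (x^* y) of quaternion vectors turns the
    statement into Euclidean geometry.  For x = a + b epsilon the case
    distinctions in the two norms disappear after squaring:
      ||x||^2 = |a|^2 + 2 <a, b> epsilon
    ([normdqv_sqr]), and x has unit norm iff |a|^2 = 1 and <a, b> = 0
    ([unit_dqvE]).  So for a unit vector v = c + d epsilon,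
      ||v - q||^2 = |c - a|^2 + 2 <c - a, d - b> epsilon,
    to be minimized lexicographically.

    If a <> 0, put r = |a| and e = a / r.  Minimizing the standard part
    |c - a|^2 = 1 - 2 r <c, e> + r^2 means maximizing <c, e> over unit vectors,
    and <c, e> = 1 - |c - e|^2 / 2 ([dotv_unit]) shows that c = e is the only
    maximizer.  Once c = e, the relation <c, d> = 0 makes the infinitesimal part
    2 (1 - r) <e, d - b> = - 2 (1 - r) <e, b> independent of d: every unit vector
    with standard part e is a minimizer, and the normalization of q is one.

    If a = 0, the standard part is always |c|^2 = 1 and the infinitesimal part is
    - 2 <c, b>, again because <c, d> = 0; by the same identity it is least for
    c = b / |b|. *)

(** * The lexicographic order and the ring of dual numbers *)

Lemma led_Dual (R : realDomainType) (a a' b b' : R) :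
  (Dual a a' <= Dual b b')%O = (a < b) || (a == b) && (a' <= b').
Proof.
rewrite [LHS]/Order.le /= /led /ltd /=.
rewrite (_ : (Dual a a' == Dual b b') = (a == b) && (a' == b')) //.
rewrite orbCA; congr orb.
by rewrite -andb_orr -le_eqVlt.
Qed.

Lemma dual_sqr (R : comNzRingType) (a b : R) :
  Dual a b ^+ 2 = Dual (a ^+ 2) (2 * (a * b)).
Proof. by rewrite expr2; congr Dual => /=; ring. Qed.

Lemma dual_sum (A : zmodType) (I : Type) (s : seq I) (f g : I -> A) :
  \sum_(i <- s) Dual (f i) (g i) =
    Dual (\sum_(i <- s) f i) (\sum_(i <- s) g i).
Proof. by elim: s => [|i s IH]; rewrite ?big_nil // !big_cons IH. Qed.

(** * The Euclidean structure of quaternions and quaternion vectors *)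

(* [rat] also exports a [normq]. *)
Local Notation normq := Defs.normq.

Section Euclid.
Variable R : rcfType.
Implicit Types p q : quat R.

Definition dotq p q : R := sc (conjq p * q).

Lemma scE q : sc q = q0 q.
Proof. by rewrite /sc /=; field. Qed.

Lemma dotqE p q :
  dotq p q = q0 p * q0 q + q1 p * q1 q + q2 p * q2 q + q3 p * q3 q.
Proof. by rewrite /dotq scE /=; ring. Qed.

Lemma normq_sqr q : normq q ^+ 2 = dotq q q.
Proof. by rewrite sqr_sqrtr ?addr_ge0 ?sqr_ge0 // dotqE !expr2. Qed.

Lemma dotqq_ge0 q : 0 <= dotq q q.
Proof. by rewrite -normq_sqr sqr_ge0. Qed.

Lemma dotqq_eq0 q : (dotq q q == 0) = (q == 0).
Proof.
apply/eqP/eqP => [|->]; last by rewrite dotqE /= !mul0r !addr0.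
case: q => a b c d; rewrite dotqE /= -!expr2 => h.
have [[[ha hb] hc] hd] := (sqr_ge0 a, sqr_ge0 b, sqr_ge0 c, sqr_ge0 d).
by rewrite -[RHS]/(Quat 0 0 0 0); congr Quat; apply/eqP; rewrite -sqrf_eq0; apply/eqP; lra.
Qed.

Variable n : nat.
Implicit Types x y z : 'cV[quat R]_n.

Definition dotv x y : R := sc ((conjtr x *m y) 0 0).

Lemma dotvE x y : dotv x y = \sum_i dotq (x i 0) (y i 0).
Proof.
rewrite /dotv scE mxE (big_morph (@q0 R) (id1 := 0) (op1 := +%R)) //.
by apply: eq_bigr => i _; rewrite /dotq scE !mxE.
Qed.

Lemma dotvC x y : dotv x y = dotv y x.
Proof. by rewrite !dotvE; apply: eq_bigr => i _; rewrite !dotqE; ring. Qed.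

Lemma dotvBl x y z : dotv (x - y) z = dotv x z - dotv y z.
Proof.
rewrite !dotvE -sumrB; apply: eq_bigr => i _.
by rewrite !mxE !dotqE /=; ring.
Qed.

Lemma dot0v x : dotv 0 x = 0.
Proof. by rewrite -(subrr x) dotvBl subrr. Qed.

Lemma dotvBr x y z : dotv x (y - z) = dotv x y - dotv x z.
Proof. by rewrite dotvC dotvBl !(dotvC x). Qed.

Lemma dotvZl (a : R) x y : dotv (scalemq a x) y = a * dotv x y.
Proof.
rewrite !dotvE mulr_sumr; apply: eq_bigr => i _.
by rewrite !mxE !dotqE /=; ring.
Qed.

Lemma dotvZr (a : R) x y : dotv x (scalemq a y) = a * dotv x y.
Proof. by rewrite dotvC dotvZl dotvC. Qed.

Lemma conjtrZ (a : R) x : conjtr (scalemq a x) = scalemq a (conjtr x).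
Proof. by apply/matrixP => i j; rewrite !mxE; congr Quat => /=; rewrite mulrN. Qed.

Lemma dotvv_ge0 x : 0 <= dotv x x.
Proof. by rewrite dotvE sumr_ge0 // => i _; apply: dotqq_ge0. Qed.

Lemma dotvv_eq0 x : (dotv x x == 0) = (x == 0).
Proof.
rewrite dotvE psumr_eq0 => [|i _]; last exact: dotqq_ge0.
apply/allP/eqP => [h|-> i _]; last by rewrite dotqq_eq0 mxE eqxx.
apply/matrixP => i j; rewrite ord1 mxE.
by apply/eqP; rewrite -dotqq_eq0; apply: h; rewrite mem_index_enum.
Qed.

Lemma dotvv_gt0 x : (0 < dotv x x) = (x != 0).
Proof. by rewrite lt_def dotvv_ge0 andbT dotvv_eq0. Qed.

Lemma normqvE x : normqv x = Num.sqrt (dotv x x).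
Proof.
by rewrite /normqv dotvE; congr Num.sqrt; apply: eq_bigr => i _; rewrite normq_sqr.
Qed.

Lemma normqv_sqr x : normqv x ^+ 2 = dotv x x.
Proof. by rewrite normqvE sqr_sqrtr // dotvv_ge0. Qed.

Lemma normqv_gt0 x : (0 < normqv x) = (x != 0).
Proof. by rewrite normqvE sqrtr_gt0 dotvv_gt0. Qed.

Lemma dotv_normalize x :
  x != 0 -> dotv (scalemq (normqv x)^-1 x) (scalemq (normqv x)^-1 x) = 1.
Proof.
rewrite -normqv_gt0 => x0; rewrite dotvZl dotvZr -normqv_sqr.
by field; rewrite gt_eqF.
Qed.

Lemma normalizeK x : x != 0 -> scalemq (normqv x) (scalemq (normqv x)^-1 x) = x.
Proof.
rewrite -normqv_gt0 => x0; apply/matrixP => i j.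
by rewrite !mxE scalerA divff ?scale1r // gt_eqF.
Qed.

(** The polarization identity for unit vectors; it gives both the
    Cauchy-Schwarz bound <x, y> <= 1 and its equality case x = y. *)
Lemma dotv_unit x y : dotv x x = 1 -> dotv y y = 1 ->
  dotv x y = 1 - dotv (x - y) (x - y) / 2.
Proof. by move=> hx hy; rewrite dotvBl !dotvBr hx hy (dotvC y x); field. Qed.

Lemma dotv_unit_le1 x y : dotv x x = 1 -> dotv y y = 1 -> dotv x y <= 1.
Proof.
by move=> hx hy; rewrite dotv_unit //; have := dotvv_ge0 (x - y); lra.
Qed.

Lemma dotv_unit_eq1 x y :
  dotv x x = 1 -> dotv y y = 1 -> dotv x y = 1 -> x = y.
Proof.
move=> hx hy; rewrite dotv_unit // => h.
by apply/eqP; rewrite -subr_eq0 -dotvv_eq0; apply/eqP; lra.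
Qed.

Lemma dotv_dist_sqr (r : R) x y : dotv x x = 1 -> dotv y y = 1 ->
  dotv (x - scalemq r y) (x - scalemq r y) = 1 - 2 * r * dotv x y + r ^+ 2.
Proof.
move=> hx hy; rewrite dotvBl !dotvBr !(dotvZl, dotvZr) hx hy (dotvC y x).
by ring.
Qed.

(** * The norm of dual quaternion vectors *)

Implicit Types v w : 'cV[dual (quat R)]_n.

Lemma stvB v w : stv (v - w) = stv v - stv w.
Proof. by apply/matrixP => i j; rewrite !mxE. Qed.

Lemma infvB v w : infv (v - w) = infv v - infv w.
Proof. by apply/matrixP => i j; rewrite !mxE. Qed.

Lemma stv_dualv x y : stv (dualv x y) = x.
Proof. by apply/matrixP => i j; rewrite !mxE. Qed.

Lemma infv_dualv x y : infv (dualv x y) = y.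
Proof. by apply/matrixP => i j; rewrite !mxE. Qed.

(** The two branches of the magnitude agree after squaring: when the standard
    part vanishes, both sides are 0 because epsilon^2 = 0. *)
Lemma normdq_sqr (q : dual (quat R)) :
  normdq q ^+ 2 = Dual (dotq (stpart q) (stpart q))
                       (2 * dotq (stpart q) (infpart q)).
Proof.
rewrite /normdq; case: ifPn => [q0|/negPn/eqP ->]; rewrite dual_sqr.
  have r0 : normq (stpart q) != 0.
    by rewrite -sqrf_eq0 normq_sqr dotqq_eq0.
  by rewrite normq_sqr -/(dotq _ _) [normq _ * _]mulrCA divff // mulr1.
by rewrite !dotqE /= !mul0r !addr0 mulr0 expr0n.
Qed.

Lemma sum_normdq_sqr v :
  \sum_(i < n) normdq (v i 0) ^+ 2 =
    Dual (dotv (stv v) (stv v)) (2 * dotv (stv v) (infv v)).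
Proof.
rewrite (eq_bigr _ (fun i _ => normdq_sqr (v i 0))) dual_sum !dotvE.
by congr Dual; rewrite ?mulr_sumr; apply: eq_bigr => i _; rewrite !mxE.
Qed.

Lemma normdqv_st v : stv v != 0 ->
  normdqv v = Dual (normqv (stv v)) (dotv (stv v) (infv v) / normqv (stv v)).
Proof.
move=> v0; rewrite /normdqv v0 sum_normdq_sqr /sqrtd /= -normqvE.
have := v0; rewrite -normqv_gt0 => r0.
by congr Dual; field; rewrite gt_eqF.
Qed.

Lemma normdqv_sqr v :
  normdqv v ^+ 2 = Dual (dotv (stv v) (stv v)) (2 * dotv (stv v) (infv v)).
Proof.
have [v0|v0] := eqVneq (stv v) 0.
  rewrite /normdqv v0 eqxx /= dual_sqr !dot0v.
  by rewrite mul0r mulr0 expr0n.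
have := v0; rewrite -normqv_gt0 => r0.
rewrite normdqv_st // dual_sqr normqv_sqr [normqv _ * _]mulrCA divff ?mulr1 //.
by rewrite gt_eqF.
Qed.

Lemma unit_dqvE v :
  normdqv v = 1 <-> dotv (stv v) (stv v) = 1 /\ dotv (stv v) (infv v) = 0.
Proof.
split=> [v1|[h1 h0]].
  have := normdqv_sqr v; rewrite v1 expr1n => -[<- h]; split=> //; lra.
have v0 : stv v != 0 by rewrite -dotvv_eq0 h1 oner_neq0.
by rewrite normdqv_st // normqvE h1 sqrtr1 h0 mul0r.
Qed.

Lemma normdqvB_sqr v w :
  normdqv (v - w) ^+ 2 = Dual (dotv (stv v - stv w) (stv v - stv w))
                              (2 * dotv (stv v - stv w) (infv v - infv w)).
Proof. by rewrite normdqv_sqr stvB infvB. Qed.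

(** * Projection onto the unit vectors *)

(** Only the standard part of a unit vector decides whether it is a projection:
    the orthogonality of its two parts fixes the infinitesimal part of the
    distance to [w]. *)
Lemma argmin_of_st v w : stv w != 0 -> normdqv v = 1 ->
  stv v = scalemq (normqv (stv w))^-1 (stv w) ->
  argmin (unit_dqv R n) (fun v => normdqv (v - w) ^+ 2) v.
Proof.
move=> w0 v1 ve; split; [exact: v1 | move=> v' v'1].
have [h1 h0] := (unit_dqvE v).1 v1; have [h1' h0'] := (unit_dqvE v').1 v'1.
have r0 : 0 < normqv (stv w) by rewrite normqv_gt0.
have := normalizeK _ w0; rewrite -ve => ew.
rewrite [leLHS]normdqvB_sqr [leRHS]normdqvB_sqr led_Dual -ew !dotv_dist_sqr // h1.
have := dotv_unit_le1 _ _ h1' h1; rewrite le_eqVlt => /orP[/eqP ee|lt1].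
  have e := dotv_unit_eq1 _ _ h1' h1 ee; rewrite e h1 eqxx in h0' *.
  by rewrite !(dotvBl, dotvBr, dotvZl) h0 h0' lexx orbT.
(* Here <stv v', stv v> < 1, so the standard parts already compare strictly. *)
by rewrite ltrD2r ltrD2l ltrN2 ltr_pM2l ?mulr_gt0 // lt1.
Qed.

(** The standard part of ||v - w||^2 is 1 for every unit vector v, so the
    comparison takes place in the infinitesimal part, where w enters through
    - 2 <stv v, infv w>. *)
Lemma argmin_of_inf v w : stv w = 0 -> infv w != 0 -> normdqv v = 1 ->
  stv v = scalemq (normqv (infv w))^-1 (infv w) ->
  argmin (unit_dqv R n) (fun v => normdqv (v - w) ^+ 2) v.
Proof.
move=> w0 wi0 v1 ve; split; [exact: v1 | move=> v' v'1].
have [h1 h0] := (unit_dqvE v).1 v1; have [h1' h0'] := (unit_dqvE v').1 v'1.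
have r0 : 0 < normqv (infv w) by rewrite normqv_gt0.
have := normalizeK _ wi0; rewrite -ve => ew.
rewrite [leLHS]normdqvB_sqr [leRHS]normdqvB_sqr led_Dual w0 !subr0 h1 h1' eqxx -ew ltxx /=.
rewrite !dotvBr !dotvZr h0 h0' h1 !sub0r ler_pM2l // lerN2 ler_pM2l //.
exact: dotv_unit_le1.
Qed.

(** Dividing by |a| + (<a, b> / |a|) epsilon subtracts from b / |a| its
    component along a / |a|. *)
Lemma normalize_dualv v : stv v != 0 ->
  let r := normqv (stv v) in
  divdqv v (normdqv v) =
    dualv (scalemq r^-1 (stv v))
      (scalemq r^-1 (infv v)
       - scalemq (dotv (scalemq r^-1 (stv v)) (scalemq r^-1 (infv v)))
           (scalemq r^-1 (stv v))).
Proof.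
move=> v0 r; rewrite normdqv_st // -/r.
apply/matrixP => i j; rewrite !mxE /divdq /=; congr Dual; congr (_ - _ *: _).
by rewrite dotvZl dotvZr; ring.
Qed.

Lemma normdqv_normalize v : stv v != 0 -> normdqv (divdqv v (normdqv v)) = 1.
Proof.
move=> v0; apply/unit_dqvE; rewrite normalize_dualv // stv_dualv infv_dualv.
by rewrite dotvBr (dotvZr (dotv _ _)) dotv_normalize // mulr1 subrr.
Qed.

End Euclid.

Theorem theorem3p3 (R : realType) (n : nat) (q : 'cV[dual (quat R)]_n) :
  (stv q != 0 ->
    let u := divdqv q (normdqv q) in
    let r := normqv (stv q) in
    let ust := scalemq r^-1 (stv q) in
    let uinf :=
      scalemq r^-1 (infv q)
      - scalemq
          (sc ((scalemq r^-1 (conjtr (stv q)) *m scalemq r^-1 (infv q)) 0 0))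
          (scalemq r^-1 (stv q)) in
    [/\ u = dualv ust uinf,
        normdqv u = 1
      & argmin (unit_dqv R n) (fun v => normdqv (v - q) ^+ 2) u])
  /\
  (stv q = 0 -> infv q != 0 ->
    forall uinf : 'cV[quat R]_n,
      sc ((conjtr (infv q) *m uinf) 0 0) = 0 ->
      argmin (unit_dqv R n) (fun v => normdqv (v - q) ^+ 2)
        (dualv (scalemq (normqv (infv q))^-1 (infv q)) uinf)).
Proof.
split=> [qst0 u r ust uinf|qst0 qinf0 uinf uq].
  have uE : u = dualv ust uinf.
    by rewrite /uinf -conjtrZ; apply: normalize_dualv.
  have u1 : normdqv u = 1 by apply: normdqv_normalize.
  split; [exact: uE | exact: u1 |].
  by apply: (argmin_of_st _ _ _ _ qst0 u1); rewrite uE stv_dualv.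
apply: (argmin_of_inf _ _ _ _ qst0 qinf0); last by rewrite stv_dualv.
apply/unit_dqvE; rewrite stv_dualv infv_dualv; split; first exact: dotv_normalize.
by rewrite dotvZl [dotv _ _ _ _]uq mulr0.
Qed.
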